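(* Let $\mathtt{T}=(\Sigma,Ax)$ be a theory. Then: (1) if $\Upsilon\vdash_{\mathtt{T}}\pi\curlywedge t$ then $\Upsilon\vDash^s_{\mathtt{T}}\pi\curlywedge t$; (2) if $\Upsilon\vdash_{\mathtt{T}}t=u$ then $\Upsilon\vDash^s_{\mathtt{T}}t=u$.
   Context: Syntax. Atoms $\mathbb{A}$ and variables $\mathbb{V}$ are disjoint countably infinite sets; $\Sigma$ is a finite set of term-formers with arities. $\mathrm{Perm}(\mathbb{A})$ is the group of bijections of $\mathbb{A}$ with finite $\mathrm{dom}(\pi)=\{a\mid\pi(a)\ne a\}$; $(a\ b)$ is a swapping; $\pi^{\rho}=\rho\circ\pi\circ\rho^{-1}$. Nominal terms: $t::=a\mid\pi\cdot X\mid[a]t\mid\mathsf{f}(t_1,\ldots,t_n)$ ($X$ abbreviates $\mathrm{id}\cdot X$). Action on terms: $\pi\cdot a=\pi(a)$, $\pi\cdot(\pi'\cdot X)=(\pi\circ\pi')\cdot X$, $\pi\cdot[a]t=[\pi(a)](\pi\cdot t)$, $\pi\cdot\mathsf{f}(\vec t)=\mathsf{f}(\pi\cdot\vec t)$. $\mathrm{var}(t)$ is the set of variables in $t$. Substitutions $\sigma$ map finitely many variables to terms and extend homomorphically, with $(\pi\cdot X)\sigma=\pi\cdot(X\sigma)$. A fixed-point context $\Upsilon$ is a finite set of constraints $\gamma\curlywedge X$; $\mathrm{perm}(\Upsilon|_X)=\{\gamma\mid\gamma\curlywedge X\in\Upsilon\}$, $\mathrm{dom}(\mathrm{perm}(\Upsilon|_X))=\bigcup_{\gamma\in\mathrm{perm}(\Upsilon|_X)}\mathrm{dom}(\gamma)$.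 Judgements: $\Upsilon\vdash\pi\curlywedge t$ and $\Upsilon\vdash t=u$. A theory $\mathtt{T}=(\Sigma,Ax)$ has a set $Ax$ of axioms $\Upsilon'\vdash t=u$. Rules (''fresh'' atoms are pairwise distinct and occur nowhere in the conclusion): $(\curlywedge\mathbf a)$ $\Upsilon\vdash\pi\curlywedge a$ if $\pi(a)=a$; $(\curlywedge\mathsf f)$ from $\Upsilon\vdash\pi\curlywedge t_i$ ($1\le i\le n$) infer $\Upsilon\vdash\pi\curlywedge\mathsf f(t_1,\ldots,t_n)$; $(\curlywedge\mathbf{var})$ $\Upsilon\vdash\pi\curlywedge\pi'\cdot X$ if $\mathrm{dom}(\pi^{\pi'^{-1}})\subseteq\mathrm{dom}(\mathrm{perm}(\Upsilon|_X))$; $(\curlywedge\mathbf{abs})$ from $\Upsilon\cup\{(c_1\ c_2)\curlywedge Y\mid Y\in\mathrm{var}(t)\}\vdash\pi\curlywedge(a\ c_1)\cdot t$ infer $\Upsilon\vdash\pi\curlywedge[a]t$ ($c_1,c_2$ fresh); $(\mathbf{refl})$, $(\mathbf{symm})$, $(\mathbf{tran})$ for $=$; $(\mathbf{ax}_{\Upsilon'\vdash t=u})$ for $(\Upsilon'\vdash t=u)\in Ax$, any permutation $\pi$ and substitution $\sigma$: from $\Upsilon\vdash\pi'^{\pi}\curlywedge\pi\cdot(X\sigma)$ for every $\pi'\curlywedge X\in\Upsilon'$ infer $\Upsilon\vdash\pi\cdot(t\sigma)=\pi\cdot(u\sigma)$; $(\mathbf{cong}[])$ from $\Upsilon\vdash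 t=u$ infer $\Upsilon\vdash[a]t=[a]u$; $(\mathbf{cong}\mathsf f)$ from $\Upsilon\vdash t=u$ infer $\Upsilon\vdash\mathsf f(\ldots,t,\ldots)=\mathsf f(\ldots,u,\ldots)$; $(\mathbf{fr})$ from $\Upsilon\cup\{\pi\curlywedge X\}\vdash t=u$ with $\mathrm{dom}(\pi)\subseteq\mathrm{dom}(\mathrm{perm}(\Upsilon|_X))$ infer $\Upsilon\vdash t=u$; $(\mathbf{perm})$ from $\Upsilon\cup\{(c_1\ c_2)\curlywedge Y\mid Y\in\mathrm{var}(t)\}\vdash(a\ c_1)\curlywedge t$ and $\Upsilon\cup\{(d_1\ d_2)\curlywedge Y\mid Y\in\mathrm{var}(t)\}\vdash(b\ d_1)\curlywedge t$ infer $\Upsilon\vdash(a\ b)\cdot t=t$ ($c_1,c_2,d_1,d_2$ fresh). $\Upsilon\vdash_{\mathtt T}J$ means $J$ is derivable from hypotheses in $\Upsilon$, using only axioms of $Ax$ and terms over $\Sigma$. Semantics. A nominal set is a $\mathrm{Perm}(\mathbb{A})$-set each of whose elements has a finite support; it is strong if each element $x$ has a finite $B$ with: $\pi$ fixes $B$ pointwise iff $\pi\cdot x=x$. A (strong) nominal $\Sigma$-algebra: a (strong) nominal set $\mathsf A$, equivariant $\mathtt{atom}:\mathbb{A}\to|\mathsf A|$, equivariant $\mathtt{abs}:\mathbb{A}\times|\mathsf A|\to|\mathsf A|$ with $\{c\mid(a\ c)\cdot\mathtt{abs}(a,x)\ne\mathtt{abs}(a,x)\}$ finite for all $a,x$,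 and equivariant $f:|\mathsf A|^n\to|\mathsf A|$ for each $\mathsf f:n$. For a valuation $\varsigma:\mathbb{V}\to|\mathsf A|$: $[\![a]\!]_\varsigma=\mathtt{atom}(a)$, $[\![\pi\cdot X]\!]_\varsigma=\pi\cdot\varsigma(X)$, $[\![\mathsf f(\vec t)]\!]_\varsigma=f([\![\vec t]\!]_\varsigma)$, $[\![[a]t]\!]_\varsigma=\mathtt{abs}(a,[\![t]\!]_\varsigma)$. $[\![\Upsilon]\!]_\varsigma$ is valid iff $\gamma\cdot\varsigma(X)=\varsigma(X)$ for all $\gamma\curlywedge X\in\Upsilon$; $[\![\Upsilon\vdash\pi\curlywedge t]\!]_\varsigma$ valid iff ($[\![\Upsilon]\!]_\varsigma$ valid implies $\pi\cdot[\![t]\!]_\varsigma=[\![t]\!]_\varsigma$); $[\![\Upsilon\vdash t=u]\!]_\varsigma$ valid iff ($[\![\Upsilon]\!]_\varsigma$ valid implies $[\![t]\!]_\varsigma=[\![u]\!]_\varsigma$). A strong model of $\mathtt T$ is a strong nominal $\Sigma$-algebra in which every axiom of $Ax$ is valid for every valuation. $\Upsilon\vDash^s_{\mathtt T}J$ means $[\![\Upsilon\vdash J]\!]_\varsigma$ is valid for every strong model of $\mathtt T$ and every valuation $\varsigma$. *)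

(* Defs.v *)
From HB Require Import structures.
From mathcomp Require Import all_boot.
From mathcomp Require Import finmap.
From mathcomp Require Import boolp classical_sets cardinality.

Set Implicit Arguments.
Unset Strict Implicit.
Unset Printing Implicit Defensive.

Local Open Scope fset_scope.

(* Perm(A): a bijection of A moving finitely many atoms is a finitely supported
   function that is injective. Such functions are represented canonically, so
   that equality of permutations is Leibniz equality and finite sets of
   permutations make sense. *)

Record fperm (A : choiceType) :=
  FPerm { fperm_val :> {fsfun A -> A}; _ : fsinjectiveb fperm_val }.

HB.instance Definition _ (A : choiceType) := [isSub for @fperm_val A].
HB.instance Definition _ (A : choiceType) := [Choice of fperm A by <:].

Section PermutationGroup.
Variable A : choiceType.
Implicit Types (p q r : fperm A) (a b c : A).

Lemma fperm_inj p : injective p.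
Proof. exact/fsinjectiveP/(valP p). Qed.

Lemma fpermP p q : p =1 q <-> p = q.
Proof. by split=> [pq|->//]; apply/val_inj/fsfunP. Qed.

Definition dom p : {fset A} := finsupp p.

Lemma mem_dom p a : (a \in dom p) = (p a != a).
Proof. exact: mem_finsupp. Qed.

Fact fperm_one_subproof : fsinjectiveb ([fsfun] : {fsfun A -> A}).
Proof. by apply/fsinjectiveP => a b; rewrite !fsfun0E. Qed.
Definition fperm_one : fperm A := FPerm fperm_one_subproof.

Fact fperm_mul_subproof p q : fsinjectiveb (fsfun_comp p q).
Proof. by apply/fsinjectiveP/fscomp_inj; apply: fperm_inj. Qed.
Definition fperm_mul p q : fperm A := FPerm (fperm_mul_subproof p q).

Definition fperm_inv_fun p : {fsfun A -> A} :=
  [fsfun a in dom p => nth a (dom p) (index a [seq p b | b <- dom p])].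

Lemma fperm_inv_funK p : cancel (fperm_inv_fun p) p.
Proof.
move=> a; rewrite fsfunE; case: ifPn => [a_p|]; last exact: fsfun_dflt.
have a_im : a \in [seq p b | b <- dom p].
  have /imfset_eq_fsinjectiveP im_p := valP p.
  move: (a_p); rewrite -[X in _ \in X -> _]im_p => /imfsetP[b /= b_p ->].
  exact: map_f.
by rewrite -(nth_map a a) ?nth_index // -(size_map p) index_mem.
Qed.

Fact fperm_inv_subproof p : fsinjectiveb (fperm_inv_fun p).
Proof. exact/fsinjectiveP/(can_inj (fperm_inv_funK p)). Qed.
Definition fperm_inv p : fperm A := FPerm (fperm_inv_subproof p).

Fact fperm_mulA : associative fperm_mul.
Proof. by move=> p q r; apply/val_inj/fscompA. Qed.
Fact fperm_mul1g : left_id fperm_one fperm_mul.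
Proof. by move=> p; apply/fpermP=> a; rewrite fscompE /= fsfun0E. Qed.
Fact fperm_mulg1 : right_id fperm_one fperm_mul.
Proof. by move=> p; apply/fpermP=> a; rewrite fscompE /= fsfun0E. Qed.
Fact fperm_mulgV : right_inverse fperm_one fperm_inv fperm_mul.
Proof.
by move=> p; apply/fpermP=> a; rewrite fscompE /= fperm_inv_funK fsfun0E.
Qed.
Fact fperm_mulVg : left_inverse fperm_one fperm_inv fperm_mul.
Proof.
move=> p; apply/fpermP=> a; rewrite fscompE /=; apply: (@fperm_inj p).
by rewrite fperm_inv_funK fsfun0E.
Qed.

HB.instance Definition _ := isGroup.Build (fperm A)
  fperm_mulA fperm_mul1g fperm_mulg1 fperm_mulVg fperm_mulgV.

(* Products are compositions of functions, unlike for {perm T}. *)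
Lemma fpermM p q a : (p * q)%g a = p (q a).
Proof. exact: fscompE. Qed.

Lemma fperm1 a : (1%g : fperm A) a = a.
Proof. exact: fsfun0E. Qed.

Lemma fpermK p : cancel p (p^-1)%g.
Proof. by move=> a; rewrite -fpermM mulVg fperm1. Qed.

Lemma fpermKV p : cancel (p^-1)%g p.
Proof. by move=> a; rewrite -fpermM mulgV fperm1. Qed.

Fact swap_subproof a b :
  fsinjectiveb ([fsfun [fsfun] with a |-> b, b |-> a] : {fsfun A -> A}).
Proof.
apply/fsinjectiveP => c d; rewrite !fsfun_withE !fsfun0E /=.
by do 4?[case: eqP]; congruence.
Qed.
Definition swap a b : fperm A := FPerm (swap_subproof a b).

Lemma swapE a b c :
  swap a b c = if c == a then b else if c == b then a else c.
Proof. by rewrite /= !fsfun_withE fsfun0E. Qed.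

(* p^r = r o p o r^-1; mathcomp's [p ^ r] is r^-1 * p * r. *)
Definition pconj p r : fperm A := (r * p * r^-1)%g.

End PermutationGroup.

Record signature := Signature { former :> finType; arity : former -> nat }.

Section Syntax.
Variables (A V : choiceType) (S : signature).

Unset Elimination Schemes.
Inductive term :=
| Atom of A
| Susp of fperm A & V
| Abs of A & term
| App (f : S) of {ffun 'I_(arity f) -> term}.
Set Elimination Schemes.

Lemma term_ind (P : term -> Prop) :
  (forall a, P (Atom a)) ->
  (forall p X, P (Susp p X)) ->
  (forall a t, P t -> P (Abs a t)) ->
  (forall f (ts : {ffun 'I_(arity f) -> term}),
     (forall i, P (ts i)) -> P (App ts)) ->
  forall t, P t.
Proof.
move=> Patom Psusp Pabs Papp; fix IH 1 => -[a|p X|a t|f ts].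
- exact: Patom.
- exact: Psusp.
- exact/Pabs/IH.
- by apply: Papp => i; apply: IH.
Qed.

Implicit Types (p : fperm A) (t u : term) (X Y : V).

Fixpoint tact p t : term :=
  match t with
  | Atom a => Atom (p a)
  | Susp q X => Susp (p * q)%g X
  | Abs a t => Abs (p a) (tact p t)
  | App f ts => App [ffun i => tact p (ts i)]
  end.

Fixpoint vars t : {fset V} :=
  match t with
  | Atom _ => fset0
  | Susp _ X => [fset X]
  | Abs _ t => vars t
  | App f ts => \bigcup_(i in 'I_(arity f)) vars (ts i)
  end.

(* The atoms occurring in a permutation are those it moves. *)
Fixpoint term_atoms t : {fset A} :=
  match t with
  | Atom a => [fset a]
  | Susp p _ => dom p
  | Abs a t => a |` term_atoms t
  | App f ts => \bigcup_(i in 'I_(arity f)) term_atoms (ts i)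
  end.

(* A finite partial map; variables outside its domain are left unchanged. *)
Definition subst := {fmap V -> term}.

Definition subst_var (s : subst) X : term :=
  if s.[? X]%fmap is Some t then t else Susp 1%g X.

Fixpoint tsubst (s : subst) t : term :=
  match t with
  | Atom a => Atom a
  | Susp p X => tact p (subst_var s X)
  | Abs a t => Abs a (tsubst s t)
  | App f ts => App [ffun i => tsubst s (ts i)]
  end.

Inductive judgement :=
| FixJ of fperm A & term
| EqJ of term & term.

Definition judgement_atoms (J : judgement) : {fset A} :=
  match J with
  | FixJ p t => dom p `|` term_atoms t
  | EqJ t u => term_atoms t `|` term_atoms u
  end.

End Syntax.

Arguments Atom {A V S}.
Arguments Susp {A V S}.
Arguments Abs {A V S}.
Arguments App {A V S f}.
Arguments FixJ {A V S}.
Arguments EqJ {A V S}.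

Section Contexts.
Variables (A V : choiceType).

Definition context := {fset fperm A * V}.

Implicit Types (U : context) (X : V).

Definition ctx_perms U X : {fset fperm A} := [fset g.1 | g in U & g.2 == X].

Definition ctx_dom U X : {fset A} := \bigcup_(p <- ctx_perms U X) dom p.

Definition ctx_atoms U : {fset A} := \bigcup_(g <- U) dom g.1.

Definition swap_ctx (c1 c2 : A) (Ys : {fset V}) : context :=
  [fset (swap c1 c2, Y) | Y in Ys].

Definition sequent_atoms S U (J : judgement A V S) : {fset A} :=
  ctx_atoms U `|` judgement_atoms J.

Definition fresh_atoms (cs : seq A) (B : {fset A}) : bool :=
  uniq cs && all (fun c => c \notin B) cs.

End Contexts.

Record theory (A V : choiceType) := Theory {
  theory_sig : signature;
  Ax : context A V -> term A V theory_sig -> term A V theory_sig -> Prop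
}.

Section Derivability.
Variables (A V : choiceType) (T : theory A V).
Implicit Types (U : context A V) (p q : fperm A) (a b c d : A) (X : V).
Implicit Types (t u : term A V (theory_sig T)).

Inductive derivable : context A V -> judgement A V (theory_sig T) -> Prop :=
| deriv_fix_atom U p a :
    p a = a ->
    derivable U (FixJ p (Atom a))
| deriv_fix_app U p (f : theory_sig T)
    (ts : {ffun 'I_(arity f) -> term A V (theory_sig T)}) :
    (forall i, derivable U (FixJ p (ts i))) ->
    derivable U (FixJ p (App ts))
| deriv_fix_var U p q X :
    dom (pconj p q^-1%g) `<=` ctx_dom U X ->
    derivable U (FixJ p (Susp q X))
| deriv_fix_abs U p a t c1 c2 :
    fresh_atoms [:: c1; c2] (sequent_atoms U (FixJ p (Abs a t))) ->
    derivable (U `|` swap_ctx c1 c2 (vars t)) (FixJ p (tact (swap a c1) t)) ->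
    derivable U (FixJ p (Abs a t))
| deriv_eq_refl U t :
    derivable U (EqJ t t)
| deriv_eq_symm U t u :
    derivable U (EqJ t u) ->
    derivable U (EqJ u t)
| deriv_eq_tran U t u v :
    derivable U (EqJ t u) ->
    derivable U (EqJ u v) ->
    derivable U (EqJ t v)
| deriv_eq_ax U U' t u p (s : subst A V (theory_sig T)) :
    Ax U' t u ->
    (forall p' X, (p', X) \in U' ->
       derivable U (FixJ (pconj p' p) (tact p (subst_var s X)))) ->
    derivable U (EqJ (tact p (tsubst s t)) (tact p (tsubst s u)))
| deriv_eq_abs U a t u :
    derivable U (EqJ t u) ->
    derivable U (EqJ (Abs a t) (Abs a u))
| deriv_eq_app U (f : theory_sig T) (i : 'I_(arity f))
    (ts us : {ffun 'I_(arity f) -> term A V (theory_sig T)}) :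
    (forall j, j != i -> ts j = us j) ->
    derivable U (EqJ (ts i) (us i)) ->
    derivable U (EqJ (App ts) (App us))
| deriv_eq_fr U p X t u :
    dom p `<=` ctx_dom U X ->
    derivable ((p, X) |` U) (EqJ t u) ->
    derivable U (EqJ t u)
(* a and b are displayed in the conclusion, even if (a b).t and t do not
   mention them. *)
| deriv_eq_perm U a b t c1 c2 d1 d2 :
    fresh_atoms [:: c1; c2; d1; d2]
      ([fset a; b] `|` sequent_atoms U (EqJ (tact (swap a b) t) t)) ->
    derivable (U `|` swap_ctx c1 c2 (vars t)) (FixJ (swap a c1) t) ->
    derivable (U `|` swap_ctx d1 d2 (vars t)) (FixJ (swap b d1) t) ->
    derivable U (EqJ (tact (swap a b) t) t).

End Derivability.

Record permSet (A : choiceType) := PermSet {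
  carrier :> Type;
  act : fperm A -> carrier -> carrier;
  act1 : forall x, act 1%g x = x;
  actM : forall p q x, act (p * q)%g x = act p (act q x)
}.

Definition supports (A : choiceType) (N : permSet A) (B : {fset A}) (x : N) :=
  forall p : fperm A, {in B, forall a, p a = a} -> act p x = x.

Record nominalSet (A : choiceType) := NominalSet {
  nominal_permSet :> permSet A;
  finite_support : forall x : nominal_permSet, exists B, supports B x
}.

Definition strong (A : choiceType) (N : nominalSet A) : Prop :=
  forall x : N, exists B : {fset A},
    forall p : fperm A, {in B, forall a, p a = a} <-> act p x = x.

Record nominalAlgebra (A : choiceType) (S : signature) := NominalAlgebra {
  alg_nominalSet :> nominalSet A;
  alg_atom : A -> alg_nominalSet;
  alg_abs : A -> alg_nominalSet -> alg_nominalSet;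
  alg_op : forall f : S,
    {ffun 'I_(arity f) -> alg_nominalSet} -> alg_nominalSet;
  alg_atom_equiv : forall p a, act p (alg_atom a) = alg_atom (p a);
  alg_abs_equiv : forall p a x,
    act p (alg_abs a x) = alg_abs (p a) (act p x);
  alg_abs_finite : forall a x, finite_set
    [set c | act (swap a c) (alg_abs a x) <> alg_abs a x]%classic;
  alg_op_equiv : forall p (f : S)
    (xs : {ffun 'I_(arity f) -> alg_nominalSet}),
    act p (alg_op xs) = alg_op [ffun i => act p (xs i)]
}.

Section Semantics.
Variables (A V : choiceType) (S : signature) (M : nominalAlgebra A S).
Variable v : V -> M.

Fixpoint interp (t : term A V S) : M :=
  match t with
  | Atom a => alg_atom M a
  | Susp p X => act p (v X)
  | Abs a t => alg_abs a (interp t)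
  | App f ts => alg_op [ffun i => interp (ts i)]
  end.

Definition valid_ctx (U : context A V) : Prop :=
  forall p X, (p, X) \in U -> act p (v X) = v X.

Definition valid (U : context A V) (J : judgement A V S) : Prop :=
  valid_ctx U ->
  match J with
  | FixJ p t => act p (interp t) = interp t
  | EqJ t u => interp t = interp u
  end.

End Semantics.

Definition strong_model (A V : choiceType) (T : theory A V)
    (M : nominalAlgebra A (theory_sig T)) : Prop :=
  strong M /\
  forall U t u, Ax U t u -> forall v : V -> M, valid v U (EqJ t u).

Definition strongly_entails (A V : choiceType) (T : theory A V)
    (U : context A V) (J : judgement A V (theory_sig T)) : Prop :=
  forall M : nominalAlgebra A (theory_sig T), strong_model M ->
  forall v : V -> M, valid v U J.

(* Main.v *)
(* Induction on derivations, the hypothesis being validity for every valuation.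
   The atoms chosen fresh in a rule may lie in the supports of the values of
   the current valuation; but the interpretation is equivariant, so acting on
   the valuation by a permutation that fixes the atoms of the conclusion moves
   them out of these supports, where their swappings fix the valuation.
   Strongness enters through the domains of permutations: [p] fixes [x] iff
   [dom p] avoids the support of [x], so a permutation whose domain is covered
   by those of permutations fixing [x] fixes [x] as well. *)

Require Import Defs.
From mathcomp Require Import all_boot finmap classical_sets cardinality.
From mathcomp Require Import boolp.

Set Implicit Arguments.
Unset Strict Implicit.
Unset Printing Implicit Defensive.

Local Open Scope fset_scope.

Lemma fresh_atom (A : choiceType) (D : {fset A}) :
  infinite_set [set: A]%classic -> exists a, a \notin D.
Proof.
move=> infA; apply: contrapT => noA; apply: infA.
have -> : [set: A]%classic = [set` D]%classic; last exact: finite_fset.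
apply/seteqP; split=> a // _ /=.
by apply/negPn/negP => aD; apply: noA; exists a.
Qed.

(** By induction on [cs]: the permutation for the tail is followed by the swapping of the head with
    an atom outside everything used so far. *)
Lemma freshening (A : choiceType) (cs : seq A) (E D : {fset A}) :
    infinite_set [set: A]%classic -> fresh_atoms cs E ->
  exists2 r : fperm A, {in E, forall a, r a = a} &
    {in cs, forall c, r c \notin D}.
Proof.
move=> infA; elim: cs E D => [|c cs IH] E D.
  by move=> _; exists 1%g => // a _; rewrite fperm1.
rewrite /fresh_atoms /= => /andP[/andP[c_cs cs_uniq] /andP[cE csE]].
(* With [c] added to both sets, [r] fixes [c] and sends no atom of the tail to [c]; swapping [c]
   with an atom outside these images then leaves them alone. *)
have [|r rE rcs] := IH (c |` E) (c |` D).
  apply/andP; split=> //; apply/allP => x x_cs.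
  rewrite !inE negb_or (allP csE) // andbT.
  by apply: contraNneq c_cs => <-.
have [c' c'P] := fresh_atom (c |` E `|` D `|` [fset r x | x in cs]) infA.
move: c'P; rewrite !inE !negb_or -!andbA => /and4P[c'c c'E c'D c'r].
exists (swap c c' * r)%g => [a aE|x].
  rewrite fpermM rE ?inE ?aE ?orbT // swapE.
  case: eqP => [ac|_]; first by rewrite -ac aE in cE.
  by case: eqP => // ac'; rewrite -ac' aE in c'E.
rewrite inE fpermM => /predU1P[->|x_cs].
  by rewrite rE ?inE ?eqxx // swapE eqxx.
move: (rcs x x_cs); rewrite !inE negb_or => /andP[/negPf rxc rxD].
rewrite swapE rxc; case: eqP => // rx.
by case/negP: c'r; rewrite -rx; apply/imfsetP; exists x.
Qed.

Section Permutations.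
Variable A : choiceType.
Implicit Types (p q r : fperm A) (B : {fset A}).

(** Being injective, [r] maps the complement of [dom p] into itself; there [p] is the identity,
    while on [dom p] it is [r] that is. *)
Lemma fperm_commute p r :
  {in dom p, forall a, r a = a} -> (r * p = p * r)%g.
Proof.
move=> rp; apply/fpermP => a; rewrite !fpermM.
have [ap|] := boolP (a \in dom p).
  rewrite (rp a) // rp //.
  by move: ap; rewrite !mem_dom; apply: contra_neq => /fperm_inj.
rewrite mem_dom negbK => /eqP pa; rewrite pa.
apply/esym/eqP; rewrite -[_ == _]negbK -mem_dom; apply/negP => rap.
by move: (rp _ rap) => /fperm_inj raE; rewrite raE mem_dom pa eqxx in rap.
Qed.

Lemma fix_swap a b B :
  a \notin B -> b \notin B -> {in B, forall c, swap a b c = c}.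
Proof.
move=> aB bB c cB; rewrite swapE.
case: eqP => [ca|_]; first by rewrite -ca cB in aB.
by case: eqP => // cb; rewrite -cb cB in bB.
Qed.

Lemma swap_notin a b B :
  a != b -> {in B, forall c, swap a b c = c} -> a \notin B.
Proof.
by move=> ab fixB; apply/negP => /fixB; rewrite swapE eqxx => /eqP;
   rewrite eq_sym (negPf ab).
Qed.

Lemma act_pconj (N : permSet A) p q (x : N) :
  act (pconj p q) (act q x) = act q x <-> act p x = x.
Proof.
rewrite -actM /pconj mulgVK actM; split=> [pqx|->//].
by rewrite -(act1 (act p x)) -(mulVg q) actM pqx -actM mulVg act1.
Qed.

End Permutations.

Section Interpretation.
Variables (A V : choiceType) (S : signature) (M : nominalAlgebra A S).
Implicit Types (v : V -> M) (t : term A V S) (p r : fperm A).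
Implicit Types (U : context A V) (J : judgement A V S).

Lemma interp_tact v p t : interp v (tact p t) = act p (interp v t).
Proof.
elim: t => /= [a|q X|a t IH|f ts IH].
- by rewrite alg_atom_equiv.
- by rewrite actM.
- by rewrite alg_abs_equiv IH.
- by rewrite alg_op_equiv; congr alg_op; apply/ffunP => i; rewrite !ffunE IH.
Qed.

Lemma interp_tsubst v (s : subst A V S) t :
  interp v (tsubst s t) = interp (fun X => interp v (subst_var s X)) t.
Proof.
elim: t => //= [q X|a t ->//|f ts IH]; first exact: interp_tact.
by congr alg_op; apply/ffunP => i; rewrite !ffunE IH.
Qed.

Lemma eq_interp v w t :
  {in vars t, forall X, v X = w X} -> interp v t = interp w t.
Proof.
elim: t => //= [q X|a t IH|f ts IH] vw; first by rewrite vw ?inE.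
  by rewrite IH.
congr alg_op; apply/ffunP => i; rewrite !ffunE; apply: IH => X Xi.
by apply: vw; apply/bigfcupP; exists i => //; rewrite mem_index_enum.
Qed.

(** At a suspension [Susp q X] the permutation [r] passes to the valuation because it fixes [dom q]
    and hence commutes with [q]. *)
Lemma act_interp v r t :
  {in term_atoms t, forall a, r a = a} ->
  act r (interp v t) = interp (fun X => act r (v X)) t.
Proof.
elim: t => /= [a|q X|a t IH|f ts IH] rt.
- by rewrite alg_atom_equiv rt ?inE.
- by rewrite -!actM fperm_commute.
- rewrite alg_abs_equiv rt ?inE ?eqxx // IH // => b bt.
  by rewrite rt // !inE bt orbT.
- rewrite alg_op_equiv; congr alg_op; apply/ffunP => i; rewrite !ffunE.
  apply: IH => b bi; apply: rt.
  by apply/bigfcupP; exists i => //; rewrite mem_index_enum.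
Qed.

(* The semantic counterpart of renaming the atoms of a derivation. *)
Lemma valid_act v U J r :
    {in sequent_atoms U J, forall a, r a = a} ->
  valid (fun X => act r (v X)) U J -> valid v U J.
Proof.
move=> rUJ validJ vU.
have act_inj : injective (@act A M r).
  by apply: (can_inj (g := act r^-1%g)) => x; rewrite -actM mulVg act1.
have rJ : {in judgement_atoms J, forall a, r a = a}.
  by move=> a aJ; rewrite rUJ // !inE aJ orbT.
have /validJ : valid_ctx (fun X => act r (v X)) U.
  move=> p X pU; rewrite -actM -fperm_commute ?actM ?(vU p) // => a ap.
  rewrite rUJ // inE; apply/orP; left.
  by apply/bigfcupP; exists (p, X) => //; rewrite pU.
case: J rJ {rUJ validJ} => [p t|t u] /= rJ.
  rewrite -act_interp => [|a at_]; last by rewrite rJ // !inE at_ orbT.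
  rewrite -actM -fperm_commute ?actM => [/act_inj//|a ap].
  by rewrite rJ // !inE ap.
by rewrite -!act_interp => [/act_inj//|a aJ|a aJ];
   rewrite rJ // !inE aJ ?orbT.
Qed.

(** Lets a rule be checked only at valuations on which its fresh atoms behave as semantically fresh:
    any other valuation is first renamed by the inverse of a freshening. *)
Lemma valid_fresh U J (cs : seq A) (Ys : {fset V}) :
    infinite_set [set: A]%classic -> fresh_atoms cs (sequent_atoms U J) ->
    (forall v, {in Ys, forall Y, {in cs &, forall c d,
       act (swap c d) (v Y) = v Y}} -> valid v U J) ->
  forall v, valid v U J.
Proof.
move=> infA csP validJ v.
have /choice[B vB] : forall Y, exists B, supports B (v Y).
  by move=> Y; apply: finite_support.
have [r rUJ rcs] := freshening (\bigcup_(Y <- Ys) B Y) infA csP.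
have r'UJ : {in sequent_atoms U J, forall a, r^-1%g a = a}.
  by move=> a aUJ; rewrite -{1}(rUJ a aUJ) fpermK.
apply: (valid_act r'UJ); apply: validJ => Y YYs c d c_cs d_cs.
(* Conjugated by [r], the swapping of [c] and [d] exchanges [r c] and [r d], which lie outside
   [B Y]. *)
rewrite -[X in act X _](mulKg r) -actM -mulgA actM; congr act.
apply: vB => a aB.
have aBs : a \in \bigcup_(Y <- Ys) B Y.
  by apply/bigfcupP; exists Y => //; rewrite YYs.
rewrite !fpermM swapE.
case: eqP => [rac|_].
  by case/negP: (rcs c c_cs); rewrite -rac fpermKV.
case: eqP => [rad|_]; last by rewrite fpermKV.
by case/negP: (rcs d d_cs); rewrite -rad fpermKV.
Qed.

Hypothesis strongM : strong M.

Lemma act_ctx_dom v U X p :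
  valid_ctx v U -> dom p `<=` ctx_dom U X -> act p (v X) = v X.
Proof.
move=> vU pU; have [B BP] := strongM (v X); apply/BP => a aB.
apply/eqP; rewrite -[_ == _]negbK -mem_dom; apply/negP => ap.
have /bigfcupP[q /[!andbT] /imfsetP[[q' Y] /=]] := fsubsetP pU a ap.
rewrite !inE /= => /andP[gU /eqP YX] -> {q}; rewrite mem_dom => /eqP[].
by have /BP -> : act q' (v X) = v X by rewrite -YX; apply: vU.
Qed.

(** In a strong algebra, a swapping of two distinct atoms fixes [x] only if both lie outside the
    support of [x]. *)
Lemma act_swap_trans (x : M) a b c d :
    act (swap a c) x = x -> act (swap b d) x = x -> a != c -> b != d ->
  act (swap a b) x = x.
Proof.
have [B BP] := strongM x; move=> /BP fac /BP fbd ac bd; apply/BP.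
exact: fix_swap (swap_notin ac fac) (swap_notin bd fbd).
Qed.

(** Both atoms are fresh for the abstraction: [a] by the finiteness condition on [alg_abs], and [c]
    because [swap c d] fixes [a] and [x]. *)
Lemma act_swap_abs (infA : infinite_set [set: A]%classic) a c d (x : M) :
    act (swap c d) x = x -> c != d -> a != c -> a != d ->
  act (swap a c) (alg_abs a x) = alg_abs a x.
Proof.
move=> cdx cd ac ad.
have cdax : act (swap c d) (alg_abs a x) = alg_abs a x.
  by rewrite alg_abs_equiv cdx swapE (negPf ac) (negPf ad).
have /finite_fsetP[F FE] := alg_abs_finite a x.
have [e] := fresh_atom (a |` F) infA; rewrite !inE negb_or => /andP[ea eF].
apply: (act_swap_trans (c := e) _ cdax _ cd); last by rewrite eq_sym.
apply: contrapT => neq; case/negP: eF.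
by have : [set` F]%classic e by rewrite -FE.
Qed.

End Interpretation.

Lemma soundness (A V : choiceType) (T : theory A V) U
    (J : judgement A V (theory_sig T)) :
    infinite_set [set: A]%classic ->
  derivable U J -> strongly_entails U J.
Proof.
move=> infA UJ M [strongM axM].
elim: {U J} UJ.
- by move=> U p a pa v _ /=; rewrite alg_atom_equiv pa.
- move=> U p f ts _ IH v vU /=; rewrite alg_op_equiv; congr alg_op.
  by apply/ffunP => i; rewrite !ffunE IH.
(* Conjugation by [q^-1] reduces fixing [act q (v X)] to fixing [v X], as the side condition
   requires. *)
- move=> U p q X pU v vU /=; apply/(act_pconj _ q^-1%g).
  by rewrite -[act q^-1%g _]actM mulVg act1 (act_ctx_dom strongM vU).
- move=> U p a t c1 c2 fr _ IH.
  apply: (valid_fresh infA fr (Ys := vars t)) => v vcs vU /=.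
  move: fr; rewrite /fresh_atoms /= !inE !negb_or -!andbA.
  move=> /and5P[c12 _ _ c1p /and5P[c1a c1t _ _ /and3P[c2a c2t _]]].
  have c12t : act (swap c1 c2) (interp v t) = interp v t.
    rewrite act_interp; last exact: fix_swap.
    by apply: eq_interp => X Xt; apply: vcs; rewrite ?inE ?eqxx ?orbT.
  (* Semantic alpha-renaming of the bound [a] to [c1], an atom that [p] fixes; the premise then
     handles the renamed body. *)
  rewrite -(act_swap_abs strongM infA c12t) //; last 2 first.
  + by rewrite eq_sym.
  + by rewrite eq_sym.
  rewrite alg_abs_equiv alg_abs_equiv swapE eqxx -interp_tact; congr alg_abs.
    by apply/eqP; move: c1p; rewrite mem_dom negbK.
  apply: IH => q X; rewrite inE => /orP[/vU//|/imfsetP[Y /= Yt [-> ->]]].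
  by apply: vcs; rewrite ?inE ?eqxx ?orbT.
- by [].
- by move=> U t u _ IH v vU /=; rewrite IH.
- by move=> U t u w _ IH1 _ IH2 v vU /=; rewrite IH1 // IH2.
- move=> U U' t u p s tu _ IH v vU /=; rewrite !interp_tact !interp_tsubst.
  (* The axiom is used at the valuation sending each variable to the value of its substitute. *)
  congr act; apply: (axM _ _ _ tu) => q X qU'.
  apply/(act_pconj q p); rewrite -interp_tact.
  exact: IH.
- by move=> U a t u _ IH v vU /=; rewrite IH.
- move=> U f i ts us tsus _ IH v vU /=; congr alg_op; apply/ffunP => j.
  by rewrite !ffunE; have [->|/tsus->//] := eqVneq j i; apply: IH.
(* The extra constraint already holds under [v], by strongness. *)
- move=> U p X t u pU _ IH v vU; apply: IH => q Y.
  rewrite !inE => /predU1P[[-> ->]|/vU//].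
  exact: act_ctx_dom pU.
- move=> U a b t c1 c2 d1 d2 fr _ IHc _ IHd.
  set J := EqJ _ _ in fr *.
  have frJ : fresh_atoms [:: c1; c2; d1; d2] (sequent_atoms U J).
    move: fr; rewrite /fresh_atoms => /andP[-> /allP fr]; apply/allP => c /fr.
    by rewrite inE negb_or => /andP[].
  apply: (valid_fresh infA frJ (Ys := vars t)) => v vcs vU /=.
  rewrite interp_tact.
  have swapU c d : c \in [:: c1; c2; d1; d2] -> d \in [:: c1; c2; d1; d2] ->
      valid_ctx v (U `|` swap_ctx c d (vars t)).
    move=> c_cs d_cs q X.
    rewrite inE => /orP[/vU//|/imfsetP[Y /= Yt [-> ->]]].
    exact: vcs.
  (* Freshness for the displayed [a] and [b] makes the swappings [swap a c1] and [swap b d1]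
     nontrivial. *)
  have neq x c : x \in [fset a; b] -> c \in [:: c1; c2; d1; d2] -> x != c.
    move=> xab c_cs; case/andP: fr => _ /allP /(_ c c_cs).
    by rewrite inE negb_or => /andP[cab _]; apply: contraNneq cab => <-.
  apply: (act_swap_trans strongM (c := c1) (d := d1)).
  + by apply: IHc; apply: swapU; rewrite !inE eqxx ?orbT.
  + by apply: IHd; apply: swapU; rewrite !inE eqxx ?orbT.
  + by apply: neq; rewrite !inE eqxx ?orbT.
  + by apply: neq; rewrite !inE eqxx ?orbT.
Qed.

Theorem theorem4p1 (A V : countType)
    (infA : infinite_set [set: A]%classic)
    (infV : infinite_set [set: V]%classic)
    (T : theory A V) :
  (forall (U : context A V) (p : fperm A) (t : term A V (theory_sig T)),
     derivable U (FixJ p t) -> strongly_entails U (FixJ p t)) /\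
  (forall (U : context A V) (t u : term A V (theory_sig T)),
     derivable U (EqJ t u) -> strongly_entails U (EqJ t u)).
Proof. by split=> *; apply: soundness. Qed.
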